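(* For every integer $i\ge 7$, taking the Fibonacci word $F_i$ as the text, the net frequency of $F_{i-2}$ in $F_i$ satisfies $\phi(F_{i-2})\ge 1$.
   Context: Fibonacci words: $F_1=\texttt{b}$, $F_2=\texttt{a}$, $F_i=F_{i-1}F_{i-2}$ for $i\ge 3$. For a text $T$ of length $n$ and $1\le s\le e\le n$, let $f(W)$ be the number of occurrences of $W$ in $T$. An occurrence $(s,e)$ is a net occurrence if $f(T[s\ldots e])\ge 2$, $f(T[s-1\ldots e])=1$ and $f(T[s\ldots e+1])=1$, where the second condition is considered true when $s=1$ and the third when $e=n$. The net frequency $\phi(S)$ of $S$ in $T$ is the number of net occurrences $(s,e)$ with $T[s\ldots e]=S$. *)

(* Defs.v *)
From HB Require Import structures.
From mathcomp Require Import all_boot.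

Set Implicit Arguments.
Unset Strict Implicit.
Unset Printing Implicit Defensive.

Inductive letter := la | lb.

Definition bool_of_letter (x : letter) : bool := if x is la then true else false.
Definition letter_of_bool (b : bool) : letter := if b then la else lb.

Lemma bool_of_letterK : cancel bool_of_letter letter_of_bool.
Proof. by case. Qed.

HB.instance Definition _ := Equality.copy letter (can_type bool_of_letterK).

(* The sequence starts at index 1; the value at 0 is junk. *)
Fixpoint fibword (i : nat) : seq letter :=
  match i with
  | 0 => [::]
  | 1 => [:: lb]
  | 2 => [:: la]
  | (i''.+1 as i').+1 => fibword i' ++ fibword i''
  end.

Section Text.
Variable A : eqType.
Implicit Types (T S W : seq A) (s e : nat).

(* T[s..e], with 1-based inclusive positions *)
Definition factor T s e : seq A := drop s.-1 (take e T).

(* all (s, e) with 1 <= s <= e <= size T, each listed once *)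
Definition intervals T : seq (nat * nat) :=
  [seq (s, e) | s <- index_iota 1 (size T).+1, e <- index_iota s (size T).+1].

(* An occurrence is an interval, so the empty word has none. *)
Definition occ_num T W : nat :=
  count (fun p => factor T p.1 p.2 == W) (intervals T).

Definition net_occ T s e : bool :=
  [&& 1 <= s <= e, e <= size T,
      2 <= occ_num T (factor T s e),
      (s == 1) || (occ_num T (factor T s.-1 e) == 1)
    & (e == size T) || (occ_num T (factor T s e.+1) == 1)].

Definition net_freq T S : nat :=
  count (fun p => net_occ T p.1 p.2 && (factor T p.1 p.2 == S)) (intervals T).

End Text.

(* Main.v *)
Require Import Defs.
From mathcomp Require Import all_boot zify.

Set Implicit Arguments.
Unset Strict Implicit.

(** With [W = F_(i-2)] and [V = F_(i-3)], the words [WV] and [VW] are [Pxy] and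
    [Pyx] for distinct letters [x], [y], so the text [F_i = WVW] is [WPyx], where
    [WP] is a prefix of [WWW]. As [W] is primitive (it has coprime length and
    number of a's), it occurs inside [WP] only at offsets [0] and [|W|]; it cannot
    end at the penultimate letter of the text either, which is [y] whereas [W]
    ends with [x]. The only other occurrence is the suffix, preceded by the last
    letter [y] of [V], whereas the occurrence at [|W|] is preceded by [x]. Hence
    [yW] is unique and the suffix [W] is a net occurrence. *)

Section Words.
Variable A : eqType.
Implicit Types (u v w T S : seq A) (a : pred A).

(** Commuting words are powers of one word, so every letter has the same density in both. The proof
    runs Euclid's algorithm: a nonempty shorter word is a prefix of the longer one, and stripping it
    leaves a smaller commuting pair. *)
Lemma count_commute a u v :
  u ++ v = v ++ u -> count a u * size v = count a v * size u.
Proof.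
have [n] := ubnP (size u + size v); elim: n u v => // n IHn u v.
wlog le_uv : u v / size u <= size v => [wl|] lt_n uv.
  have [/wl|/ltnW le_vu] := leqP (size u) (size v); first exact.
  by apply/esym/wl; rewrite // addnC.
case: u => [|x u] in le_uv lt_n uv *; first by rewrite muln0.
have def_v : v = (x :: u) ++ drop (size (x :: u)) v.
  have := congr1 (take (size (x :: u))) uv.
  by rewrite take_size_cat // takel_cat // => {1}->; rewrite cat_take_drop.
move: (drop _ _) def_v => v' def_v; rewrite {}def_v in lt_n uv *.
have /IHn : size (x :: u) + size v' < n by move: lt_n; rewrite size_cat /=; lia.
have {}uv : (x :: u) ++ v' = v' ++ (x :: u).
  by move: uv; rewrite -catA => /eqP; rewrite eqseq_cat // => /andP[_ /eqP].
by move=> /(_ uv); rewrite size_cat count_cat mulnDr mulnDl => ->.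
Qed.

(** The two pieces exchanged by the rotation commute, so by proportionality [size w] divides
    [count a w * r], hence [r]. *)
Lemma coprime_count_rot a w r :
  coprime (size w) (count a w) -> r < size w -> rot r w = w -> r = 0.
Proof.
move=> cop lt_r rot_w.
have := @count_commute a (take r w) (drop r w).
rewrite cat_take_drop => /(_ (esym rot_w)) prop.
have size_take_r : size (take r w) = r by rewrite size_take lt_r.
have def_size : size w = r + size (drop r w).
  by rewrite size_drop subnKC // ltnW.
have def_count : count a w = count a (take r w) + count a (drop r w).
  by rewrite -count_cat cat_take_drop.
have : size w %| count a w * r.
  apply/dvdnP; exists (count a (take r w)).
  by rewrite def_count def_size mulnDl mulnDr prop size_take_r.
rewrite Gauss_dvdr //; case: (posnP r) => // r_gt0 /(dvdn_leq r_gt0); lia.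
Qed.

(** Turns an occurrence of [w] inside a power of [w] into a rotation fixing [w]. *)
Lemma take_drop_cat_rot w u p :
  p <= size w -> take (size w) (drop p (w ++ w ++ u)) = rot p w.
Proof.
move=> le_p; rewrite -[in drop p _](cat_take_drop p w) -!catA.
rewrite drop_size_cat ?size_takel // catA -/(rot p w).
by rewrite take_size_cat ?size_rot.
Qed.

Lemma take_drop_catl u v p n :
  p + n <= size u -> take n (drop p (u ++ v)) = take n (drop p u).
Proof. by rewrite addnC => le_u; rewrite !take_drop takel_cat. Qed.

Lemma factorE T p n : factor T p.+1 (p + n) = take n (drop p T).
Proof. by rewrite /factor take_drop addnC. Qed.

Lemma mem_intervals T s e :
  ((s, e) \in intervals T) = (1 <= s <= e) && (e <= size T).
Proof.
apply/allpairsPdep/idP => [[s' [e' []]]|bounds].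
  by rewrite !mem_index_iota => ? ? [-> ->]; lia.
by exists s, e; rewrite !mem_index_iota; split=> //; lia.
Qed.

Lemma intervals_uniq T : uniq (intervals T).
Proof.
apply: allpairs_uniq_dep => [|s _|]; rewrite ?iota_uniq //.
by move=> [s1 e1] [s2 e2] _ _ /= [-> ->].
Qed.

Lemma occ_num_ge2 T S p q :
  p \in intervals T -> q \in intervals T -> p != q ->
  factor T p.1 p.2 = S -> factor T q.1 q.2 = S -> 2 <= occ_num T S.
Proof.
move=> Tp Tq neq_pq Sp Sq; rewrite /occ_num -size_filter.
apply: (@uniq_leq_size _ [:: p; q]); first by rewrite /= inE neq_pq.
by move=> r; rewrite !inE mem_filter => /pred2P[]->; rewrite ?Sp ?Sq eqxx.
Qed.

Lemma occ_num_eq1 T S p :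
  p \in intervals T -> factor T p.1 p.2 = S ->
  (forall q, q \in intervals T -> factor T q.1 q.2 = S -> q = p) ->
  occ_num T S = 1.
Proof.
move=> Tp Sp uniq_p; rewrite /occ_num (@eq_in_count _ _ (pred1 p)).
  by rewrite count_uniq_mem ?intervals_uniq // Tp.
by move=> q Tq /=; apply/eqP/eqP => [/uniq_p->|->].
Qed.

Lemma size_factor T s e :
  1 <= s <= e -> e <= size T -> size (factor T s e) = e.+1 - s.
Proof. by move=> le_se le_e; rewrite size_drop size_takel //; lia. Qed.

End Words.

Arguments fibword : simpl never.

Lemma fibwordSS k : fibword k.+3 = fibword k.+2 ++ fibword k.+1.
Proof. by []. Qed.

Lemma size_fibword_gt0 k : 0 < size (fibword k.+1).
Proof. by elim: k => // -[|k] IHk //; rewrite fibwordSS size_cat ltn_addr. Qed.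

(** The counts of [la] obey the recurrence of the lengths, one index behind; coprimality with the
    length is then that of consecutive Fibonacci numbers. *)
Lemma count_la_fibword k :
  count (pred1 la) (fibword k.+2) = size (fibword k.+1).
Proof.
suff [] : count (pred1 la) (fibword k.+2) = size (fibword k.+1) /\
  count (pred1 la) (fibword k.+3) = size (fibword k.+2) by [].
elim: k => // k [IH1 IH2]; split=> //.
by rewrite fibwordSS count_cat IH1 IH2 -size_cat.
Qed.

Lemma coprime_size_fibword k :
  coprime (size (fibword k.+2)) (size (fibword k.+1)).
Proof.
elim: k => // k IHk; rewrite fibwordSS size_cat.
by rewrite /coprime gcdnC gcdnDl -/(coprime _ _).
Qed.

Lemma fibword_rot k r :
  r < size (fibword k.+2) -> rot r (fibword k.+2) = fibword k.+2 -> r = 0.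
Proof.
by apply: (@coprime_count_rot _ (pred1 la)); rewrite count_la_fibword
  coprime_size_fibword.
Qed.

Lemma fibword_near_commute k : exists (P : seq letter) (x y : letter),
  [/\ x != y,
      fibword k.+2 ++ fibword k.+1 = P ++ [:: x; y] &
      fibword k.+1 ++ fibword k.+2 = P ++ [:: y; x]].
Proof.
elim: k => [|k [P [x [y [neq_xy WV VW]]]]]; first by exists [::], la, lb.
(* Both products start with [fibword k.+2]; the remainders are the previous two products in
   exchanged order, so [x] and [y] swap. *)
exists (fibword k.+2 ++ P), y, x; rewrite eq_sym; split=> //.
  by rewrite fibwordSS -catA VW catA.
by rewrite fibwordSS WV catA.
Qed.

Lemma fibword_occurrences k p :
  let W := fibword k.+3 in let T := fibword k.+4.+1 in
  p + size W <= size T -> take (size W) (drop p T) = W ->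
  [\/ p = 0, p = size W | p = size T - size W].
Proof.
move=> W T le_p occ_p.
have [P [x [y [neq_xy WV VW]]]] := fibword_near_commute k.+1.
have rotW r : r < size W -> rot r W = W -> r = 0 := @fibword_rot k.+1 r.
have W_gt0 : 0 < size W := size_fibword_gt0 _.
have WE : W = fibword k.+2 ++ fibword k.+1 by [].
have TWVW : T = (W ++ fibword k.+2) ++ W by [].
rewrite -/W in WV VW; clearbody W T.
have TE : T = (W ++ P) ++ [:: y; x] by rewrite TWVW -!catA VW.
have sizeT : size T = size W + size P + 2 by rewrite TE !size_cat.
have sizeP : size P + 2 <= size W + size W.
  have := congr1 size WV; rewrite !size_cat /= => <-.
  by rewrite leq_add2l WE size_cat leq_addr.
(* This makes [P] a prefix of [WW], hence [WP] a prefix of [WWW]. *)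
have WWE : W ++ W = P ++ [:: x; y] ++ fibword k.+1.
  by rewrite [in X in _ ++ X]WE catA WV -catA.
have lastW : last la W = x.
  have : last la T = x by rewrite TE last_cat.
  by rewrite TWVW last_cat; case: (W) W_gt0.
(* Beyond [size P] only two offsets fit: [size P + 2], the suffix, and [size P + 1], which would put
   the last letter [x] of [W] on the penultimate letter [y] of [T]. *)
have [le_pP|lt_Pp] := leqP p (size P); last first.
  have [|neq_p] := eqVneq p (size T - size W); first by constructor 3.
  have def_p : p + size W = (size P + size W).+1 by lia.
  have := congr1 (fun w => nth la w (size W).-1) occ_p.
  rewrite nth_last lastW nth_take ?prednK // nth_drop TE nth_cat size_cat.
  rewrite (_ : p + (size W).-1 = size W + size P) ?ltnn ?subnn /=; last by lia.
  by move=> eq_yx; rewrite eq_yx eqxx in neq_xy.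
have {}occ_p : take (size W) (drop p (W ++ W ++ W)) = W.
  have le_WP : p + size W <= size (W ++ P) by rewrite size_cat; lia.
  by rewrite -[RHS]occ_p TE [in LHS]WWE catA !(take_drop_catl _ le_WP).
have [lt_pW|le_Wp] := ltnP p (size W).
  by constructor 1; rewrite take_drop_cat_rot 1?ltnW // in occ_p; apply: rotW occ_p.
have lt_pW : p - size W < size W by lia.
constructor 2; move: occ_p; rewrite drop_cat ltnNge le_Wp /=.
rewrite -[W ++ W]cats0 -catA take_drop_cat_rot 1?ltnW // => /(rotW _ lt_pW).
by lia.
Qed.

Theorem theorem8 (i : nat) (hi : 7 <= i) :
  1 <= net_freq (fibword i) (fibword (i - 2)).
Proof.
have [k ->] : exists k, i = k.+4.+1 by exists (i - 5); lia.
rewrite subSS subSS subn0.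
have [P [x [y [neq_xy WV VW]]]] := fibword_near_commute k.+1.
have occs := @fibword_occurrences k.
set W := fibword k.+3 in WV VW occs *; set T := fibword k.+4.+1 in occs *.
set V := fibword k.+2 in WV VW.
have W_gt0 : 0 < size W := size_fibword_gt0 _.
have V_gt0 : 0 < size V := size_fibword_gt0 _.
have TE : T = (W ++ V) ++ W by [].
clearbody T W V.
have sizeT : size T = size W + size V + size W by rewrite TE !size_cat.
have lastV : last la V = y.
  have := congr1 (last la) WV; rewrite !last_cat /= => <-.
  by case: (V) V_gt0.
have lastW : last la W = x.
  have := congr1 (last la) VW; rewrite !last_cat /= => <-.
  by case: (W) W_gt0.
(* [s] is the 0-based offset of the suffix [W], hence the 1-based position of the letter before
   it. *)
move def_s : (size W + size V) => s.
have suffix_W : factor T s.+1 (size T) = W.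
  by rewrite /factor take_size TE drop_size_cat // size_cat.
have Ts : (s.+1, size T) \in intervals T by rewrite mem_intervals /=; lia.
rewrite -has_count; apply/hasP; exists (s.+1, size T) => //=.
rewrite suffix_W eqxx andbT /net_occ suffix_W eqxx.
apply/and5P; split; [by lia|exact: leqnn| | |by []].
  apply: (@occ_num_ge2 _ _ _ (1, size W) (s.+1, size T)) => //=.
  - by rewrite mem_intervals /=; lia.
  - by rewrite xpair_eqE /=; lia.
  by rewrite /factor drop0 TE -catA take_size_cat.
apply/orP; right; apply/eqP.
apply: (@occ_num_eq1 _ _ _ (s, size T)) => //=.
  by rewrite mem_intervals /=; lia.
have suffix_yW : factor T s (size T) = y :: W.
  rewrite /factor take_size TE drop_cat size_cat ifT; last by move=> /=; lia.
  rewrite (drop_nth la) ?size_cat; last by move=> /=; lia.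
  rewrite prednK; last by move=> /=; lia.
  rewrite drop_oversize ?size_cat ?def_s //= nth_cat ifF; last by move=> /=; lia.
  by rewrite (_ : s.-1 - size W = (size V).-1) ?nth_last ?lastV //; lia.
rewrite suffix_yW => -[[|p] e]; rewrite mem_intervals // => /= /andP[le_pe le_e].
move=> occ_yW.
have := congr1 size occ_yW; rewrite size_factor //= => size_e.
have def_e : e = p + (size W).+1 by lia.
rewrite def_e factorE (drop_nth la) /= in occ_yW; last by move=> /=; lia.
(* Here [y] sits at 0-based offset [p] and [W] at [p.+1]. If [p.+1 = size W], the letter at [p] ends
   the first [W], so it is [x]; the last case is the suffix. *)
case: occ_yW => nth_p /occs[||eq_p|eq_p]; try lia.
  have := congr1 (fun j => nth la T j.-1) eq_p.
  rewrite /= nth_p TE -catA nth_cat ifT; last by move=> /=; lia.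
  by rewrite nth_last lastW => eq_yx; rewrite eq_yx eqxx in neq_xy.
by congr (_, _); lia.
Qed.
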